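(* For $\ell\ge 3$ and $n\ge 0$ let $g_\ell(n)$ denote the number of independent sets (including the empty set) of the graph $G_\ell^n$, with $g_\ell(0)=1$. Then \[ \sum_{n\ge0} g_4(n)x^n=\frac{1+4x-x^2-2x^3}{1-3x-14x^2+15x^3+7x^4}, \] \[ \sum_{n\ge0} g_5(n)x^n=\frac{(1+x)(1+5x-8x^2)}{1-5x-30x^2+69x^3+31x^4-22x^5}, \] \[ \sum_{n\ge0} g_6(n)x^n=\frac{1+10x-12x^2-50x^3+10x^4+20x^5-12x^6}{1-8x-66x^2+280x^3+178x^4-532x^5-84x^6+108x^7}. \]
   Context: For integers $\ell\ge 3$ and $n\ge 1$, the graph $G_\ell^n$ is defined as follows. Start with $G_\ell^1=C_\ell$, the cycle on $\ell$ vertices. Given $G_\ell^{n-1}$, whose most recently added vertices form a cycle $C$ of length $\ell$ (for $n-1=1$, the original cycle), obtain $G_\ell^{n}$ by subdividing each edge of $C$ with a new vertex (corresponding to that edge, i.e. a vertex of the line graph $L(C)$) and then adding the edges of $L(C)$ among the new vertices (two new vertices are adjacent iff the corresponding edges of $C$ share an endpoint). Explicitly, $G_\ell^n$ has vertex set $\{(j,i): 1\le j\le n,\ i\in\mathbb{Z}/\ell\mathbb{Z}\}$, and its edges are: $(j,i)(j+1,i)$ and $(j,i+1)(j+1,i)$ for $1\le j\le n-1$ and $i\in\mathbb{Z}/\ell\mathbb{Z}$, together with $(n,i)(n,i+1)$ for $i\in\mathbb{Z}/\ell\mathbb{Z}$. $G_\ell^0$ is the empty graph, which has exactly one independent set.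 *)

(* Defs.v *)
From mathcomp Require Import all_boot all_order all_algebra.

Set Implicit Arguments.
Unset Strict Implicit.
Unset Printing Implicit Defensive.

Import GRing.Theory.

Local Open Scope nat_scope.

Definition independent (T : finType) (e : rel T) (A : {set T}) : bool :=
  [forall u in A, forall v in A, ~~ e u v].

Definition num_indep (T : finType) (e : rel T) : nat :=
  #|[set A : {set T} | independent e A]|.

(* The vertex (j, i) with 1 <= j <= n and i in Z/l is (j - 1, i) here.
   [ordS] is the cyclic successor of 'I_l. *)
Definition Gvertex (l n : nat) : finType := ('I_n * 'I_l)%type.

Definition Garc (l n : nat) : rel (Gvertex l n) := fun u v =>
  [|| (v.1 == u.1.+1 :> nat) && (v.2 == u.2),
      (v.1 == u.1.+1 :> nat) && (u.2 == ordS v.2)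
    | [&& u.1.+1 == n, v.1 == u.1 & v.2 == ordS u.2]].

Definition Gadj (l n : nat) : rel (Gvertex l n) := fun u v =>
  Garc u v || Garc v u.

(* Gvertex l 0 is empty, so g l 0 = 1. *)
Definition g (l n : nat) : nat := num_indep (@Gadj l n).

Lemma Gadj_sym l n : symmetric (@Gadj l n).
Proof. by move=> u v; rewrite /Gadj orbC. Qed.

Lemma Gadj_irr l n : 1 < l -> irreflexive (@Gadj l n).
Proof.
move=> l1 [j i]; rewrite /Gadj orbb /Garc /= (ltn_eqF (ltnSn j)) /= eqxx /=.
suff -> : (i == ordS i) = false by rewrite andbF.
apply/eqP=> /(congr1 val) /=; have := ltn_ord i.
rewrite leq_eqVlt => /orP[/eqP il|il].
  by rewrite il modnn => i0; rewrite -il i0 in l1.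
by rewrite modn_small // => /eqP; rewrite (ltn_eqF (ltnSn i)).
Qed.

Lemma g0 l : g l 0 = 1.
Proof.
rewrite /g /num_indep -(card1 (set0 : {set Gvertex l 0})).
apply: eq_card => A; rewrite !inE.
have -> : A = set0 by apply/setP=> -[[]].
by rewrite eqxx; apply/forall_inP=> u; rewrite inE.
Qed.

Local Open Scope ring_scope.

(* Formal power series, as coefficient sequences. *)
Definition fps (R : Type) := nat -> R.

Definition fps_mul (R : pzSemiRingType) (a b : fps R) : fps R :=
  fun n => \sum_(i < n.+1) a i * b (n - i)%N.

Definition fps_of_poly (R : nzSemiRingType) (p : {poly R}) : fps R :=
  fun n => p`_n.

(* [fps_div a b] is the quotient in R[[x]] when the constant term of b is
   invertible: its coefficients c satisfy
     c_n = (a_n - \sum_(i < n) c_i b_(n - i)) / b_0,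
   and fps_div_seq lists c_0, ..., c_(n - 1). *)
Fixpoint fps_div_seq (R : unitRingType) (a b : fps R) (n : nat) : seq R :=
  if n is m.+1 then
    let s := fps_div_seq a b m in
    rcons s ((a m - \sum_(i < m) s`_i * b (m - i)%N) / b 0%N)
  else [::].

Definition fps_div (R : unitRingType) (a b : fps R) : fps R :=
  fun n => (fps_div_seq a b n.+1)`_n.

Lemma size_fps_div_seq (R : unitRingType) (a b : fps R) n :
  size (fps_div_seq a b n) = n.
Proof. by elim: n => //= n IHn; rewrite size_rcons IHn. Qed.

Lemma nth_fps_div_seq (R : unitRingType) (a b : fps R) n i :
  (i < n)%N -> (fps_div_seq a b n)`_i = fps_div a b i.
Proof.
elim: n => // n IHn; rewrite ltnS leq_eqVlt => /orP[/eqP-> //|lt_in].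
by rewrite [fps_div_seq _ _ _]/= nth_rcons size_fps_div_seq lt_in IHn.
Qed.

Lemma fps_divE (R : unitRingType) (a b : fps R) n :
  fps_div a b n =
    (a n - \sum_(i < n) fps_div a b i * b (n - i)%N) / b 0%N.
Proof.
rewrite {1}/fps_div /= nth_rcons size_fps_div_seq ltnn eqxx.
by congr ((_ - _) / _); apply: eq_bigr => i _; rewrite nth_fps_div_seq.
Qed.

Lemma fps_divP (R : unitRingType) (a b c : fps R) :
  b 0%N \is a GRing.unit -> (c =1 fps_div a b <-> fps_mul c b =1 a).
Proof.
move=> b0; split=> [cE n|cb].
  rewrite /fps_mul big_ord_recr /= subnn cE fps_divE divrK //.
  by under eq_bigr => i _ do rewrite cE; rewrite addrC subrK.
elim/ltn_ind=> n IHn; apply: (mulIr b0); rewrite fps_divE divrK //.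
rewrite -cb /fps_mul big_ord_recr /= subnn.
under [X in _ - X]eq_bigr => i _ do rewrite -IHn //.
by rewrite addrAC subrr add0r.
Qed.

(* The ordinary generating function \sum_n (u n) x^n. *)
Definition ogf (u : nat -> nat) : fps rat := fun n => (u n)%:R.

(* Main.v *)
(* A row of G_l^n is encoded as a list of l booleans.  The rows of an independent
   set form a walk for the relation [row_compat], started at the empty row and
   ended at an independent set of the cycle, so g l n = (T^n f)(empty row), where
   T sums over the compatible next rows and f indicates the independent sets of
   the cycle.  For a denominator b, the coefficients of b(X) \sum_n T^n f X^n are
   functions D_n of rows with D_(n+1) = T D_n + b_(n+1) f.  Hence they all vanish
   on rows from n = size b on as soon as D_(size b) does, and the theorem reduces
   to a finite computation of D_0, ..., D_(size b). *)

Require Import Defs.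
From mathcomp Require Import all_boot all_order all_algebra ssrZ ring.

Import GRing.Theory.
Local Open Scope ring_scope.

(** * Words over a finite alphabet and Boolean rows *)

Fixpoint words (T : Type) (s : seq T) (n : nat) : seq (seq T) :=
  if n is m.+1 then [seq x :: w | x <- s, w <- words T s m] else [:: [::]].

Arguments words {T} s n.

Lemma mem_words (T : eqType) (s : seq T) n w :
  (w \in words s n) = (size w == n) && all [in s] w.
Proof.
elim: n w => [|n IHn] [|x w] //=.
  by apply/allpairsP=> -[[y v] [_ _]].
apply/allpairsP/idP=> [[[y v] [ys vn [-> ->]]]|].
  by move: vn; rewrite IHn eqSS ys.
by rewrite eqSS => /and3P[wn xs ws]; exists (x, w); rewrite IHn wn.
Qed.

Lemma words_uniq (T : eqType) (s : seq T) n : uniq s -> uniq (words s n).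
Proof.
move=> us; elim: n => //= n IHn; apply: allpairs_uniq => // -[x v] [y w] _ _.
by case=> -> ->.
Qed.

Definition rows (l : nat) : seq (seq bool) := words [:: false; true] l.

Lemma mem_rows l x : (x \in rows l) = (size x == l).
Proof.
by rewrite mem_words; case: eqP => //= _; apply/allP=> -[].
Qed.

Definition empty_row (l : nat) : seq bool := nseq l false.

(** Here [y] is the row added after [x]: vertex [i] of the new row is joined to [i] and [i + 1] of
    the old one. Nothing is asked inside a row, since only the last row keeps its cycle edges. *)
Definition row_compat (l : nat) (x y : seq bool) : bool :=
  all (fun i => ~~ (nth false y i
                    && (nth false x i || nth false x (i.+1 %% l)%N))) (iota 0 l).

Definition row_indep (l : nat) (x : seq bool) : bool :=
  all (fun i => ~~ (nth false x i && nth false x (i.+1 %% l)%N)) (iota 0 l).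

Lemma row_compatP l x y :
  reflect (forall i : 'I_l, nth false y i ->
             ~~ nth false x i /\ ~~ nth false x (ordS i))
          (row_compat l x y).
Proof.
apply: (iffP allP) => [xy i yi|xy i].
  by have := xy i; rewrite mem_iota ltn_ord yi negb_or => /(_ isT)/andP.
rewrite mem_iota => /= il; have := xy (Ordinal il) => /=.
by case: nth => //= /(_ isT)[/negPf-> /negPf->].
Qed.

Lemma row_indepP l x :
  reflect (forall i : 'I_l, nth false x i -> ~~ nth false x (ordS i))
          (row_indep l x).
Proof.
apply: (iffP allP) => [xy i yi|xy i].
  by have := xy i; rewrite mem_iota ltn_ord yi => /(_ isT).
rewrite mem_iota => /= il; have := xy (Ordinal il) => /=.
by case: nth => //= /(_ isT).
Qed.

(** * Independent sets as walks on rows *)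

Definition set_of_rows (l n : nat) (L : seq (seq bool)) : {set Gvertex l n} :=
  [set u : Gvertex l n | nth false (nth [::] L u.1) u.2].

Definition valid_rows (l : nat) (x : seq bool) (L : seq (seq bool)) : bool :=
  path (row_compat l) x L && row_indep l (last x L).

Lemma independent_arcs l n (A : {set Gvertex l n}) :
  reflect (forall u v, u \in A -> v \in A -> ~~ Garc u v)
          (independent (@Gadj l n) A).
Proof.
apply: (iffP forall_inP) => [indA u v uA vA|noarc u uA].
  by have /forall_inP/(_ v vA) := indA u uA; rewrite /Gadj => /norP[].
by apply/forall_inP=> v vA; rewrite /Gadj negb_or !noarc.
Qed.

(** The first two kinds of arcs in [Garc] give the compatibility of successive rows, the third the
    independence of the last row. *)
Lemma independent_set_of_rows l n L :
  L \in words (rows l) n ->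
  independent (@Gadj l n) (set_of_rows l n L) = valid_rows l (empty_row l) L.
Proof.
rewrite mem_words => /andP[/eqP sL _]; rewrite /valid_rows.
have e0 i : nth false (empty_row l) i = false.
  by rewrite nth_nseq if_same.
apply/independent_arcs/andP=> [noarc|[/(pathP [::]) compL indL] [j i] [k m]].
  split.
    (* The step out of the initial empty row imposes no constraint. *)
    apply/(pathP [::]) => -[_|j jL]; apply/row_compatP=> i Li.
      by rewrite /= !e0.
    have jn : (j < n)%N by rewrite -sL ltnW.
    have jn1 : (j.+1 < n)%N by rewrite -sL.
    have arc (k : 'I_l) : nth false (nth [::] L j) k ->
        ~~ Garc (Ordinal jn, k) (Ordinal jn1, i).
      by move=> Lk; apply: noarc; rewrite inE.
    by split; apply/negP=> /arc; rewrite /Garc /= !eqxx ?orbT.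
  apply/row_indepP=> i; rewrite (last_nth [::]).
  (* When [n = 0] the last row is the empty row itself. *)
  case: L sL noarc => [|x L] /= sL noarc; first by rewrite e0.
  have sLn : (size L < n)%N by rewrite -sL.
  move=> Li; apply/negP=> Li1.
  have := noarc (Ordinal sLn, i) (Ordinal sLn, ordS i).
  by rewrite !inE => /(_ Li Li1); rewrite /Garc /= sL !eqxx !orbT.
rewrite !inE /= => Li Lm; apply/or3P=> -[] /=.
- case/andP=> /eqP kE /eqP mE; subst m.
  have := compL k; rewrite kE sL -{1}kE ltn_ord => /(_ isT)/row_compatP/(_ i) /=.
  by rewrite -kE Lm Li => /(_ isT)[].
- case/andP=> /eqP kE /eqP iE; subst i.
  have := compL k; rewrite kE sL -{1}kE ltn_ord => /(_ isT)/row_compatP/(_ m) /=.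
  by rewrite -kE Lm Li => /(_ isT)[].
case/and3P=> /eqP jE /eqP kE /eqP mE; subst k m.
move/row_indepP: indL => /(_ i).
by rewrite (last_nth [::]) sL -jE /= Li Lm => /(_ isT).
Qed.

(** [set_of_rows] is a bijection from lists of [n] rows of length [l] to vertex sets: it is
    injective because all sizes are fixed. *)
Lemma g_count l n :
  g l n = count (valid_rows l (empty_row l)) (words (rows l) n).
Proof.
rewrite -size_filter.
have sz L : L \in words (rows l) n ->
    size L = n /\ forall j, (j < n)%N -> size (nth [::] L j) = l.
  rewrite mem_words => /andP[/eqP sL /allP Ll]; split=> // j jn.
  by apply/eqP; rewrite -mem_rows Ll // mem_nth // sL.
rewrite -(size_map (set_of_rows l n)) /g /num_indep.
rewrite -(card_uniqP _); last first.
  rewrite map_inj_in_uniq ?filter_uniq ?words_uniq //.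
  move=> L M; rewrite !mem_filter => /andP[_ /sz[sL Ll]] /andP[_ /sz[sM Ml]].
  move=> /setP eqLM; apply: (@eq_from_nth _ [::]); rewrite ?sL ?sM // => j jn.
  apply: (@eq_from_nth _ false); rewrite ?Ll ?Ml // => i il.
  by have := eqLM (Ordinal jn, Ordinal il); rewrite !inE.
apply: eq_card => A; rewrite inE; apply/idP/mapP=> [indA|[L]]; last first.
  rewrite mem_filter => /andP[vL /independent_set_of_rows indL] ->.
  by rewrite indL.
(* The preimage of [A] is its indicator function, read row by row. *)
pose L := [seq [seq (j, i) \in A | i <- enum 'I_l] | j <- enum 'I_n].
have LA : A = set_of_rows l n L.
  apply/setP=> -[j i]; rewrite inE /= (nth_map j) ?size_enum_ord //.
  by rewrite (nth_map i) ?size_enum_ord // !nth_ord_enum.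
have Ln : L \in words (rows l) n.
  rewrite mem_words size_map size_enum_ord eqxx; apply/allP=> _ /mapP[j _ ->].
  by rewrite mem_rows size_map size_enum_ord.
exists L => //.
by rewrite mem_filter Ln andbT -(@independent_set_of_rows l n) // -LA.
Qed.

(** * The transfer operator and its generating function *)

Section Transfer.

Variables (R : comNzRingType) (l : nat).

Definition transfer (F : seq bool -> R) (x : seq bool) : R :=
  \sum_(y <- rows l | row_compat l x y) F y.

Definition final (x : seq bool) : R := (row_indep l x)%:R.

(** Splitting off the first row of the walk is one application of [transfer]. *)
Lemma count_valid_rows n x :
  (count (valid_rows l x) (words (rows l) n))%:R = iter n transfer final x.
Proof.
elim: n x => [|n IHn] x; first by rewrite /= addn0.
rewrite -sum1_count natr_sum big_mkcond big_allpairs_dep /= /transfer.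
rewrite [RHS]big_mkcond; apply: eq_bigr => y _ /=.
rewrite -IHn -sum1_count natr_sum [in RHS]big_mkcond /= /valid_rows /=.
by case: row_compat => //=; rewrite big1.
Qed.

Lemma g_transfer n : (g l n)%:R = iter n transfer final (empty_row l).
Proof. by rewrite g_count count_valid_rows. Qed.

Fixpoint conv (b : seq R) (n : nat) (x : seq bool) : R :=
  (if n is m.+1 then transfer (conv b m) x else 0) + b`_n * final x.

(** [conv b n] is $D_n$; linearity of [transfer] unfolds its recursion into a Cauchy product. *)
Lemma convE b n x :
  conv b n x = \sum_(i < n.+1) iter i transfer final x * b`_(n - i).
Proof.
elim: n x => [|n IHn] x; first by rewrite big_ord1 /= add0r mulrC.
rewrite /= big_ord_recl /= subn0 addrC mulrC; congr (_ + _).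
rewrite /transfer (eq_bigr _ (fun y _ => IHn y)) exchange_big.
by apply: eq_bigr => i _; rewrite mulr_suml.
Qed.

Lemma conv_eq0 b n :
  (size b <= n)%N -> {in rows l, forall x, conv b (size b) x = 0} ->
  {in rows l, forall x, conv b n x = 0}.
Proof.
move=> /subnKC <- b0; elim: (n - size b)%N => [|k IHk]; first by rewrite addn0.
move=> x xl; rewrite addnS /= nth_default ?leqW ?leq_addr // mul0r addr0.
by rewrite /transfer big_seq_cond big1 // => y /andP[/IHk].
Qed.

(* The values of [conv b n] on all rows, in a form suitable for [vm_compute]: the
   big operators in [conv] are locked. *)
Fixpoint conv_table (b : seq R) (n : nat) : seq (seq bool * R) :=
  if n is m.+1 then
    let t := conv_table b m in
    [seq (x, foldr (fun p s => if row_compat l x p.1 then p.2 + s else s) 0 t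
             + b`_n * final x) | x <- rows l]
  else [seq (x, b`_0 * final x) | x <- rows l].

Lemma conv_tableE b n : conv_table b n = [seq (x, conv b n x) | x <- rows l].
Proof.
elim: n => [|n IHn] /=; first by apply: eq_map => x; rewrite add0r.
rewrite IHn; apply: eq_map => x; congr (_, _ + _).
rewrite /transfer; elim: (rows l) => [|y s IHs] /=; first by rewrite big_nil.
by rewrite big_cons IHs.
Qed.

(** The second test compares the coefficients below [size b] at the empty row, which comes first in
    [rows l]. The third makes all later ones vanish, as those of [a] do by the first. *)
Definition check_fraction (a b : seq R) : bool :=
  [&& (size a <= size b)%N,
      all (fun n => (head ([::], 0) (conv_table b n)).2 == a`_n)
          (iota 0 (size b))
    & all (fun p => p.2 == 0) (conv_table b (size b))].

Lemma head_rows : exists s, rows l = empty_row l :: s.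
Proof.
rewrite /rows /empty_row; elim: l => [|k [s IHs]]; first by exists [::].
by rewrite /= IHs; eexists.
Qed.

Lemma check_fractionP a b n :
  check_fraction a b -> \sum_(i < n.+1) (g l i)%:R * b`_(n - i) = a`_n.
Proof.
case/and3P=> sab /allP ca /allP c0.
under eq_bigr => i _ do rewrite g_transfer.
rewrite -convE; have [bn|nb] := leqP (size b) n; last first.
  have := ca n; rewrite mem_iota nb => /(_ isT)/eqP <-.
  by rewrite conv_tableE; have [s ->] := head_rows.
rewrite nth_default ?(leq_trans sab) //.
apply: (conv_eq0 _ _ bn) => [x xl|]; last by rewrite mem_rows size_nseq.
apply/eqP; apply: (c0 (x, conv b (size b) x)); rewrite conv_tableE.
by apply/mapP; exists x.
Qed.

End Transfer.

(** * From integer computations to rational power series *)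

Definition ratZ : {rmorphism BinNums.Z -> rat} := intr \o int_of_Z.

(** The check runs over binary integers, where it can be evaluated, and its identity is carried to
    the rationals by [ratZ]. *)
Lemma ogf_g_fraction l (a b : seq BinNums.Z) (p q : {poly rat}) :
    check_fraction _ l a b -> b`_0 = 1 ->
    p = Poly (map ratZ a) -> q = Poly (map ratZ b) ->
  ogf (g l) =1 fps_div (fps_of_poly p) (fps_of_poly q).
Proof.
have ratZ_nth s n : (Poly (map ratZ s))`_n = ratZ s`_n.
  rewrite coef_Poly; have [sn|ns] := leqP (size s) n; last exact: nth_map.
  by rewrite !nth_default ?size_map // rmorph0.
move=> chk b0 -> ->; apply/fps_divP; rewrite /fps_of_poly.
  by rewrite ratZ_nth b0 rmorph1.
move=> n; rewrite ratZ_nth -(check_fractionP _ _ _ _ n chk) rmorph_sum.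
by apply: eq_bigr => i _; rewrite ratZ_nth rmorphM rmorph_nat.
Qed.

Ltac poly_coef :=
  rewrite !map_cons ?rmorphN ?rmorph1 !rmorph_nat;
  (* All degrees are at most 7, so coefficients 0 to 7 are compared one by one and the rest
     vanish. *)
  apply/polyP=> -[|[|[|[|[|[|[|[|i]]]]]]]]; rewrite ?mulrDl ?mul1r !coefE /=; ring.

Theorem theorem3p1 :
  [/\ ogf (g 4) =1
        fps_div
          (fps_of_poly (1 + 4 *: 'X - 'X^2 - 2 *: 'X^3))
          (fps_of_poly (1 - 3 *: 'X - 14 *: 'X^2 + 15 *: 'X^3 + 7 *: 'X^4)),
      ogf (g 5) =1
        fps_div
          (fps_of_poly ((1 + 'X) * (1 + 5 *: 'X - 8 *: 'X^2)))
          (fps_of_poly (1 - 5 *: 'X - 30 *: 'X^2 + 69 *: 'X^3 + 31 *: 'X^4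
                        - 22 *: 'X^5))
    & ogf (g 6) =1
        fps_div
          (fps_of_poly (1 + 10 *: 'X - 12 *: 'X^2 - 50 *: 'X^3 + 10 *: 'X^4
                        + 20 *: 'X^5 - 12 *: 'X^6))
          (fps_of_poly (1 - 8 *: 'X - 66 *: 'X^2 + 280 *: 'X^3 + 178 *: 'X^4
                        - 532 *: 'X^5 - 84 *: 'X^6 + 108 *: 'X^7)) ].
Proof.
split.
- apply: (ogf_g_fraction _ [:: 1; 4; -1; -2] [:: 1; -3; -14; 15; 7]).
  + by vm_compute.
  + by [].
  + by poly_coef.
  + by poly_coef.
(* The numerator expands to $1+6x-3x^2-8x^3$. *)
- apply: (ogf_g_fraction _ [:: 1; 6; -3; -8] [:: 1; -5; -30; 69; 31; -22]).
  + by vm_compute.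
  + by [].
  + by poly_coef.
  + by poly_coef.
apply: (ogf_g_fraction _ [:: 1; 10; -12; -50; 10; 20; -12]
                         [:: 1; -8; -66; 280; 178; -532; -84; 108]).
- by vm_compute.
- by [].
- by poly_coef.
- by poly_coef.
Qed.
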